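(* Let $w=w(x_1,\ldots,x_r)$ be an outer commutator word. If $u_1,\ldots,u_r$ are non-commutator words in pairwise disjoint sets of variables, then the word $w(u_1,\ldots,u_r)$ is concise. In particular, the word $w(x_1^{n_1},\ldots,x_r^{n_r})$ is concise whenever $n_1,\ldots,n_r\in\mathbb{Z}\smallsetminus\{0\}$.
   Context: Outer commutator words are defined recursively: every single variable is an outer commutator word, and if $\alpha$ and $\beta$ are outer commutator words involving disjoint sets of variables, then $[\alpha,\beta]$ is an outer commutator word. Writing $w=w(x_1,\ldots,x_r)$ means that $w$ involves exactly the variables $x_1,\ldots,x_r$. A non-commutator word is a word of the free group of infinite rank not lying in its derived subgroup, i.e. a word whose exponent sum in at least one variable is nonzero. For a word $v$ and a group $G$, $v\{G\}$ denotes the set of all values of $v$ in $G$ and $v(G)$ the subgroup generated by $v\{G\}$. A word $v$ is concise if for every group $G$ such that $v\{G\}$ is finite, the subgroup $v(G)$ is also finite. *)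

(* Defs.v *)
From Stdlib Require Import ZArith List.
Import ListNotations.

Record group := Group {
  carrier :> Type;
  gmul : carrier -> carrier -> carrier;
  ginv : carrier -> carrier;
  gone : carrier;
  gmulA : forall x y z, gmul x (gmul y z) = gmul (gmul x y) z;
  gmul1 : forall x, gmul gone x = x;
  gmulV : forall x, gmul (ginv x) x = gone
}.

(** Group words in variables x_0, x_1, ... (terms; every element of the free
    group of infinite rank is represented by such a term). *)
Inductive word : Type :=
| Var : nat -> word
| One : word
| Mul : word -> word -> word
| Inv : word -> word.

Definition Comm (a b : word) : word := Mul (Mul (Inv a) (Inv b)) (Mul a b).

Fixpoint wpow_nat (w : word) (k : nat) : word :=
  match k with O => One | S k => Mul (wpow_nat w k) w end.

Definition wpow (w : word) (n : Z) : word :=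
  match n with
  | Z0 => One
  | Zpos p => wpow_nat w (Pos.to_nat p)
  | Zneg p => Inv (wpow_nat w (Pos.to_nat p))
  end.

Fixpoint vars (w : word) : list nat :=
  match w with
  | Var n => [n]
  | One => []
  | Mul a b => vars a ++ vars b
  | Inv a => vars a
  end.

Fixpoint expsum (i : nat) (w : word) : Z :=
  match w with
  | Var n => if Nat.eqb n i then 1%Z else 0%Z
  | One => 0%Z
  | Mul a b => (expsum i a + expsum i b)%Z
  | Inv a => (- expsum i a)%Z
  end.

Definition noncommutator (w : word) : Prop := exists i, expsum i w <> 0%Z.

Inductive outer_comm : word -> Prop :=
| oc_var : forall n, outer_comm (Var n)
| oc_comm : forall a b, outer_comm a -> outer_comm b ->
    (forall x, In x (vars a) -> ~ In x (vars b)) -> outer_comm (Comm a b).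

Fixpoint subst (u : nat -> word) (w : word) : word :=
  match w with
  | Var n => u n
  | One => One
  | Mul a b => Mul (subst u a) (subst u b)
  | Inv a => Inv (subst u a)
  end.

Fixpoint eval (G : group) (f : nat -> G) (w : word) : G :=
  match w with
  | Var n => f n
  | One => gone G
  | Mul a b => gmul G (eval G f a) (eval G f b)
  | Inv a => ginv G (eval G f a)
  end.

Definition values (G : group) (v : word) (g : G) : Prop :=
  exists f : nat -> G, eval G f v = g.

Inductive generated (G : group) (S : G -> Prop) : G -> Prop :=
| gen_in : forall g, S g -> generated G S g
| gen_one : generated G S (gone G)
| gen_mul : forall g h, generated G S g -> generated G S h ->
    generated G S (gmul G g h)
| gen_inv : forall g, generated G S g -> generated G S (ginv G g).

Definition finite_set {T : Type} (S : T -> Prop) : Prop :=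
  exists l : list T, forall x, S x -> In x l.

Definition concise (v : word) : Prop :=
  forall G : group, finite_set (values G v) ->
    finite_set (generated G (values G v)).

(* Main.v *)
(* Call a set of the form S, with S conjugation-invariant and containing all
   n-th powers for some n > 0, or [X, Y] = { [x, y] }, a commutator set; the
   values of w(u_1, ..., u_r) form one. For such a set W, say that a normal
   subgroup K is good if <W> is abelian modulo K and if v in <W> lies in K as
   soon as all powers of some v^N, N > 0, are modulo K products of boundedly
   many elements of W. The heart of the matter is that a good K contains W.
   For W = S this is clear. For W = [A, B], put an element v of <W> in the
   leftmost slot of B: the resulting value of [A, B] is linear in v modulo K,
   and it lies in W when v is replaced by a suitable power, so it lies in K.
   Hence [<W>, B, ..., B, A] is in K for enough copies of B. The copies of B
   can be dropped one at a time: b |-> [a, b] is a homomorphism modulo the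
   appropriate iterated centralizer, whose preimage in <B> is good for B, so
   induction applies. When none is left, A centralizes <W> modulo K, and the
   same argument applied to a |-> [a, b] gives W in K.
   If W is finite, then <W>' is finite by Schur's theorem, so the torsion
   elements of <W> form a good subgroup. Thus W consists of torsion elements
   and <W> is finite by Dietzmann's lemma. *)

Require Import Defs.
From Stdlib Require Import ZArith List Lia Setoid Morphisms.
From Stdlib Require Import Classical ClassicalEpsilon FinFun.
Import ListNotations.

Declare Scope grp_scope.
Local Open Scope grp_scope.
Local Notation "x ** y" := (gmul _ x y) (at level 40, left associativity) : grp_scope.
Local Notation "x ^-1" := (ginv _ x) (at level 3, left associativity, format "x ^-1") : grp_scope.
Local Notation "1" := (gone _) : grp_scope.

(** * Group identities *)

Section Identities.
Context {G : group}.
Implicit Types x y z : G.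

Lemma gmulKV x y : x^-1 ** (x ** y) = y.
Proof. now rewrite gmulA, gmulV, gmul1. Qed.

Lemma gmul_cancel_l x y z : x ** y = x ** z -> y = z.
Proof. intro E. now rewrite <- (gmulKV x y), E, gmulKV. Qed.

(** The axioms are one-sided; the right inverse law comes from left cancellation, first by [x^-1]
    and then by its inverse. *)
Lemma gmulrV x : x ** x^-1 = 1.
Proof.
  apply (gmul_cancel_l x^-1). rewrite gmulKV.
  apply (gmul_cancel_l x^-1^-1). now rewrite !gmulKV, gmulV.
Qed.

Lemma gmulr1 x : x ** 1 = x.
Proof. now rewrite <- (gmulV G x), gmulA, gmulrV, gmul1. Qed.

Lemma gmulVK x y : x ** (x^-1 ** y) = y.
Proof. now rewrite gmulA, gmulrV, gmul1. Qed.

Lemma ginv_unique x y : x ** y = 1 -> x^-1 = y.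
Proof. intro E. apply (gmul_cancel_l x). now rewrite gmulrV. Qed.

Lemma ginvK x : x^-1^-1 = x.
Proof. apply ginv_unique, gmulV. Qed.

Lemma ginv1 : (1 : G)^-1 = 1.
Proof. apply ginv_unique, gmul1. Qed.

Lemma ginvM x y : (x ** y)^-1 = y^-1 ** x^-1.
Proof. apply ginv_unique. now rewrite <- gmulA, gmulVK, gmulrV. Qed.

Lemma gmulA_r x y z : x ** y ** z = x ** (y ** z).
Proof. symmetry. apply gmulA. Qed.

End Identities.

(* A confluent rewriting system for free groups. *)
#[local] Hint Rewrite @gmulA_r @gmul1 @gmulr1 @gmulV @gmulrV @gmulKV @gmulVK
  @ginvK @ginv1 @ginvM : grp.

Definition conj {G : group} (x y : G) : G := y^-1 ** x ** y.
(** Bracketed exactly like [Comm], so that evaluating [Comm a b] unfolds to this commutator. *)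
Definition comm {G : group} (x y : G) : G := x^-1 ** y^-1 ** (x ** y).

Fixpoint gpow {G : group} (x : G) (n : nat) : G :=
  match n with O => 1 | S n => x ** gpow x n end.

Ltac group_nf := unfold comm, conj in *; autorewrite with grp; try reflexivity.

(** * Powers and commutator identities *)

Section Powers.
Context {G : group}.
Implicit Types x y z : G.

Lemma gpow_add x m n : gpow x (m + n) = gpow x m ** gpow x n.
Proof. induction m; cbn; [group_nf | rewrite IHm; group_nf]. Qed.

Lemma gpow_mul x m n : gpow x (m * n) = gpow (gpow x m) n.
Proof.
  rewrite Nat.mul_comm. induction n; cbn; [easy|]. now rewrite gpow_add, IHn.
Qed.

Lemma gpow_1 x : gpow x 1 = x.
Proof. apply gmulr1. Qed.

Lemma gpow_one n : gpow (1 : G) n = 1.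
Proof. induction n; cbn; [easy | now rewrite IHn, gmul1]. Qed.

Lemma gpow_Sr x n : gpow x (S n) = gpow x n ** x.
Proof. now rewrite <- Nat.add_1_r, gpow_add, gpow_1. Qed.

Lemma gpow_inv x n : gpow x^-1 n = (gpow x n)^-1.
Proof.
  induction n; [cbn; group_nf|]. rewrite gpow_Sr, IHn. cbn. group_nf.
Qed.

Lemma gpow_conj x y n : gpow (conj x y) n = conj (gpow x n) y.
Proof. induction n; cbn; [group_nf | rewrite IHn; group_nf]. Qed.

Lemma gpow_comm x m n : gpow x m ** gpow x n = gpow x n ** gpow x m.
Proof. now rewrite <- !gpow_add, Nat.add_comm. Qed.

Lemma commV x y : (comm x y)^-1 = comm y x.
Proof. group_nf. Qed.

Lemma conjM x y z : conj (x ** y) z = conj x z ** conj y z.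
Proof. group_nf. Qed.

Lemma conjV x z : conj x^-1 z = (conj x z)^-1.
Proof. group_nf. Qed.

Lemma conj_conj x y z : conj (conj x y) z = conj x (y ** z).
Proof. group_nf. Qed.

Lemma conj_comm x y z : conj (comm x y) z = comm (conj x z) (conj y z).
Proof. group_nf. Qed.

Lemma comm_mul_l x y z : comm (x ** y) z = conj (comm x z) y ** comm y z.
Proof. group_nf. Qed.

Lemma conj_mul_comm x y : conj x y = x ** comm x y.
Proof. group_nf. Qed.

Lemma comm_conj x y : comm x y = x^-1 ** conj x y.
Proof. group_nf. Qed.

End Powers.

(** * Normal subsets and subgroups *)

Definition invariant {G : group} (X : G -> Prop) : Prop :=
  forall x y, X x -> X (conj x y).

Record normal {G : group} (K : G -> Prop) : Prop := {
  normal_1 : K 1;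
  normal_M : forall x y, K x -> K y -> K (x ** y);
  normal_V : forall x, K x -> K x^-1;
  normal_J : invariant K }.
Existing Class normal.
Arguments normal_1 {G K}. Arguments normal_M {G K}.
Arguments normal_V {G K}. Arguments normal_J {G K}.

(** Equality of cosets modulo [K]. With the [Proper] instances below, it allows rewriting in the
    quotient by [K] without constructing it. *)
Definition eqm {G : group} (K : G -> Prop) (x y : G) : Prop := K (x^-1 ** y).

Section Congruence.
Context {G : group} (K : G -> Prop) `{nK : normal G K}.

#[export] Instance eqm_equiv : Equivalence (eqm K).
Proof.
  split; unfold eqm.
  - intro x. rewrite gmulV. apply normal_1, nK.
  - intros x y H. apply (normal_V nK) in H. revert H. group_nf. easy.
  - intros x y z H H'. pose proof (normal_M nK _ _ H H') as E.
    revert E. group_nf. easy.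
Qed.

#[export] Instance eqm_mul : Proper (eqm K ==> eqm K ==> eqm K) (gmul G).
Proof.
  unfold eqm. intros x x' H y y' H'.
  pose proof (normal_M nK _ _ (normal_J nK _ y H) H') as E.
  revert E. group_nf. easy.
Qed.

#[export] Instance eqm_inv : Proper (eqm K ==> eqm K) (ginv G).
Proof.
  unfold eqm. intros x x' H.
  pose proof (normal_V nK _ (normal_J nK _ x^-1 H)) as E.
  revert E. group_nf. easy.
Qed.

#[export] Instance eqm_comm : Proper (eqm K ==> eqm K ==> eqm K) comm.
Proof. intros x x' H y y' H'. unfold comm. now rewrite H, H'. Qed.

#[export] Instance eqm_mem : Proper (eqm K ==> iff) K.
Proof.
  assert (A : forall x y, eqm K x y -> K x -> K y).
  { intros x y H H'. rewrite <- (gmulVK x y). now apply (normal_M nK). }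
  intros x y H. split; [now apply A | apply A; now symmetry].
Qed.

Lemma eqm_1 x : eqm K x 1 <-> K x.
Proof.
  split; intro H; [rewrite H; apply (normal_1 nK)|].
  unfold eqm. rewrite gmulr1. now apply (normal_V nK).
Qed.

Lemma eqm_sym_commute x y : K (comm x y) <-> eqm K (x ** y) (y ** x).
Proof.
  rewrite <- eqm_1. split; intro H.
  - transitivity (y ** x ** comm x y); [group_nf | now rewrite H, gmulr1].
  - unfold comm. rewrite H. group_nf.
Qed.

Lemma normal_comm_sym x y : K (comm x y) -> K (comm y x).
Proof. intro H. rewrite <- commV. now apply (normal_V nK). Qed.

Lemma normal_comm_l x y : K x -> K (comm x y).
Proof.
  intro H. rewrite comm_conj.
  apply (normal_M nK); [now apply (normal_V nK) | now apply (normal_J nK)].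
Qed.

Lemma normal_comm_r x y : K y -> K (comm x y).
Proof. intro H. now apply normal_comm_sym, normal_comm_l. Qed.

Lemma normal_pow x n : K x -> K (gpow x n).
Proof.
  intro H. induction n; [apply (normal_1 nK) | now apply (normal_M nK)].
Qed.

Lemma conj_eqm x y : K (comm x y) -> eqm K (conj x y) x.
Proof. intro H. rewrite conj_mul_comm, (proj2 (eqm_1 _) H), gmulr1. reflexivity. Qed.

Lemma gpow_mul_eqm x y n :
  K (comm y x) -> eqm K (gpow (x ** y) n) (gpow x n ** gpow y n).
Proof.
  intro H. apply eqm_sym_commute in H.
  assert (C : eqm K (y ** gpow x n) (gpow x n ** y)).
  { induction n; cbn; [group_nf|].
    now rewrite gmulA, H, <- gmulA, IHn, gmulA. }
  revert C. induction n; intro C; [cbn; group_nf|].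
  assert (C' : eqm K (y ** gpow x n) (gpow x n ** y)).
  { clear - nK H. induction n; cbn; [group_nf|].
    now rewrite gmulA, H, <- gmulA, IHn, gmulA. }
  cbn. rewrite IHn by exact C'.
  rewrite gmulA_r, (gmulA _ y), C'. group_nf.
Qed.

End Congruence.

(** * Generated subgroups, centralizers modulo a normal subgroup, word length *)

Section Generated.
Context {G : group}.
Implicit Types X Y K : G -> Prop.

Lemma generated_sub X K : normal K -> (forall x, X x -> K x) ->
  forall x, generated G X x -> K x.
Proof.
  intros nK H x Hx. induction Hx.
  - auto.
  - apply (normal_1 nK).
  - now apply (normal_M nK).
  - now apply (normal_V nK).
Qed.

Lemma generated_normal X : invariant X -> normal (generated G X).
Proof.
  intro iX. split; [apply gen_one | apply gen_mul | apply gen_inv |].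
  intros x y Hx. induction Hx.
  - apply gen_in, iX, H.
  - replace (conj 1 y) with (1 : G) by group_nf. apply gen_one.
  - rewrite conjM. now apply gen_mul.
  - rewrite conjV. now apply gen_inv.
Qed.

(** For normal [K], the preimage of the centralizer of the image of [Y] in the quotient by [K]. *)
Definition cent K Y : G -> Prop := fun v => forall y, Y y -> K (comm v y).

Lemma cent_normal K Y : normal K -> invariant Y -> normal (cent K Y).
Proof.
  intros nK iY. split; unfold cent.
  - intros y _. apply (normal_comm_l K), (normal_1 nK).
  - intros a b Ha Hb y Hy. rewrite comm_mul_l.
    apply (normal_M nK); [apply (normal_J nK), Ha, Hy | apply Hb, Hy].
  - intros a Ha y Hy.
    replace (comm a^-1 y) with ((conj (comm a y) a^-1)^-1) by group_nf.
    apply (normal_V nK), (normal_J nK), Ha, Hy.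
  - intros a b Ha y Hy.
    replace (comm (conj a b) y) with (conj (comm a (conj y b^-1)) b) by group_nf.
    apply (normal_J nK), Ha, iY, Hy.
Qed.

Lemma cent_generated K Y v : normal K -> cent K Y v -> cent K (generated G Y) v.
Proof.
  intros nK H y Hy. induction Hy.
  - auto.
  - apply (normal_comm_r K), (normal_1 nK).
  - replace (comm v (g ** h)) with (comm v h ** conj (comm v g) h) by group_nf.
    apply (normal_M nK); [assumption | now apply (normal_J nK)].
  - replace (comm v g^-1) with ((conj (comm v g) g^-1)^-1) by group_nf.
    now apply (normal_V nK), (normal_J nK).
Qed.

(** Since [ball_1] is available at every index, the index is an upper bound for the number of
    factors. *)
Inductive ball (X : G -> Prop) : nat -> G -> Prop :=
| ball_1 : forall n, ball X n 1
| ball_M : forall n x y, ball X n x -> X y \/ X y^-1 -> ball X (S n) (x ** y).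

Lemma ball_in X x : X x -> ball X 1 x.
Proof. intro H. rewrite <- (gmul1 G x). apply ball_M; [apply ball_1 | auto]. Qed.

Lemma ball_in_V X x : X x -> ball X 1 x^-1.
Proof.
  intro H. rewrite <- (gmul1 G x^-1). apply ball_M; [apply ball_1|].
  rewrite ginvK. auto.
Qed.

Lemma ball_le X m n x : m <= n -> ball X m x -> ball X n x.
Proof.
  intros L H. revert n L. induction H; intros k L; [apply ball_1|].
  destruct k; [lia|]. apply ball_M; [apply IHball; lia | assumption].
Qed.

Lemma ball_mul X m n x y : ball X m x -> ball X n y -> ball X (m + n) (x ** y).
Proof.
  intros Hx Hy. induction Hy.
  - rewrite gmulr1. apply ball_le with m; [lia | assumption].
  - rewrite gmulA, Nat.add_succ_r. now apply ball_M.
Qed.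

Lemma ball_inv X n x : ball X n x -> ball X n x^-1.
Proof.
  intro H. induction H.
  - rewrite ginv1. apply ball_1.
  - rewrite ginvM. apply (ball_mul X 1 n); [|assumption].
    rewrite <- (gmul1 G y^-1). apply ball_M; [apply ball_1|].
    rewrite ginvK. tauto.
Qed.

Lemma ball_generated X n x : ball X n x -> generated G X x.
Proof.
  intro H. induction H as [|n x y H IH [Hy|Hy]]; [apply gen_one | |].
  - apply gen_mul; [assumption | now apply gen_in].
  - apply gen_mul; [assumption|]. rewrite <- (ginvK y). now apply gen_inv, gen_in.
Qed.

End Generated.

(** * The vanishing theorem *)

(** For finite [X], the hypothesis of [good_pow] forces two powers of [v] to agree modulo [K].
    Stated with balls, the condition also pulls back along homomorphisms that stretch lengths by a
    bounded factor. *)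
Record good {G : group} (X K : G -> Prop) : Prop := {
  good_normal : normal K;
  good_comm : forall x y, generated G X x -> generated G X y -> K (comm x y);
  good_pow : forall v N j, generated G X v -> 0 < N ->
    (forall k, exists b, ball X j b /\ eqm K b (gpow v (N * k))) -> K v }.
Arguments good_normal {G X K}. Arguments good_comm {G X K}.
Arguments good_pow {G X K}.

Inductive commset {G : group} : (G -> Prop) -> Prop :=
| cs_leaf S n : invariant S -> 0 < n -> (forall y, S (gpow y n)) -> commset S
| cs_comm X Y : commset X -> commset Y ->
    commset (fun g => exists x y, X x /\ Y y /\ comm x y = g).

(** The maps v |-> [...[[v, y_1], y_2], ..., y_m] obtained by freeing the leftmost leaf of a
    commutator set and fixing all other entries. *)
Inductive slot {G : group} : (G -> Prop) -> (G -> G) -> Prop :=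
| slot_leaf S n : 0 < n -> (forall y, S (gpow y n)) -> slot S (fun v => v)
| slot_comm X Y l y : slot X l -> Y y ->
    slot (fun g => exists x y, X x /\ Y y /\ comm x y = g) (fun v => comm (l v) y).

Section Vanishing.
Context {G : group}.
Implicit Types X Y W K M : G -> Prop.

Lemma comm_mul_eqm K (x x' y : G) : normal K -> K (comm (comm x y) x') ->
  eqm K (comm (x ** x') y) (comm x y ** comm x' y).
Proof. intros nK H. rewrite comm_mul_l, (conj_eqm K _ _ H). reflexivity. Qed.

Lemma normal_comm_pow K (d x : G) n : normal K -> K (comm d x) -> K (comm d (gpow x n)).
Proof.
  intros nK H. induction n; cbn.
  - apply (normal_comm_r K), (normal_1 nK).
  - replace (comm d (x ** gpow x n))
      with (comm d (gpow x n) ** conj (comm d x) (gpow x n)) by group_nf.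
    apply (normal_M nK); [assumption | now apply (normal_J nK)].
Qed.

Lemma comm_pow_eqm K (x y : G) n : normal K -> K (comm (comm x y) x) ->
  eqm K (comm (gpow x n) y) (gpow (comm x y) n).
Proof.
  intros nK H. induction n; cbn.
  - replace (comm 1 y) with (1 : G) by group_nf. reflexivity.
  - rewrite comm_mul_eqm, IHn; [reflexivity | assumption |].
    now apply normal_comm_pow.
Qed.

(** For fixed [y] in [Y], the last hypothesis makes x |-> [x, y] a homomorphism from <X> to <W>
    modulo [M]. Goodness of [M] for [W] is pulled back along all of these, with lengths growing by
    the factor [c]. *)
Lemma good_cent W M X Y c : invariant W -> invariant X -> invariant Y -> good W M ->
  (forall x y, X x -> Y y -> ball W c (comm x y)) ->
  (forall d x, generated G W d -> generated G X x -> M (comm d x)) ->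
  good X (cent M Y).
Proof.
  intros iW iX iY gM Hc Hd.
  pose proof (good_normal gM) as nM.
  pose proof (generated_normal W iW) as nW.
  pose proof (generated_normal X iX) as nX.
  (* Modulo the normal subgroup <W> every element of [X] centralizes [Y], hence so does all of
     <X>. *)
  assert (DW : forall x y, generated G X x -> Y y -> generated G W (comm x y)).
  { intros x y Hx Hy.
    refine (generated_sub X (cent (generated G W) Y) _ _ x Hx y Hy).
    - now apply cent_normal.
    - intros a Ha b Hb. eapply ball_generated, Hc; assumption. }
  assert (hom : forall x x' y, generated G X x -> generated G X x' -> Y y ->
    eqm M (comm (x ** x') y) (comm x y ** comm x' y)).
  { intros x x' y Hx Hx' Hy. apply comm_mul_eqm; [assumption|]. auto. }
  assert (Hball : forall j b y, ball X j b -> Y y ->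
    exists b', ball W (j * c) b' /\ eqm M b' (comm b y)).
  { intros j b y Hb Hy. induction Hb as [n|n b z Hb IH Hz].
    - exists 1. split; [apply ball_1|].
      replace (comm 1 y) with (1 : G) by group_nf. reflexivity.
    - assert (Gz : generated G X z).
      { destruct Hz as [Hz|Hz]; [now apply gen_in|].
        rewrite <- (ginvK z). now apply gen_inv, gen_in. }
      destruct IH as (b' & Hb' & E).
      assert (exists z', ball W c z' /\ eqm M z' (comm z y)) as (z' & Hz' & Ez).
      { destruct Hz as [Hz|Hz].
        - exists (comm z y). split; [auto | reflexivity].
        (* Here [z^-1] lies in [X]; modulo [M], [z, y] is the inverse of [z^-1, y], which has length
           at most [c]. *)
        - exists ((comm z^-1 y)^-1). split; [now apply ball_inv, Hc|].
          assert (E1 : eqm M (comm (z^-1 ** z) y) 1).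
          { rewrite gmulV. replace (comm 1 y) with (1 : G) by group_nf. reflexivity. }
          rewrite hom in E1; [|now apply gen_in | assumption | assumption].
          rewrite <- (gmulKV (comm z^-1 y) (comm z y)), E1, gmulr1. reflexivity. }
      exists (b' ** z'). split.
      + cbn [Nat.mul]. rewrite Nat.add_comm. now apply ball_mul.
      + rewrite hom, E, Ez; [reflexivity | | assumption | assumption].
        eapply ball_generated, Hb. }
  split.
  - now apply cent_normal.
  - intros x x' Hx Hx' y Hy.
    assert (Hxx : generated G X (comm x x')) by (now apply (normal_comm_l _)).
    (* Apply the homomorphism to x' x [x, x'] = x x'. The images of [x] and [x'] commute modulo [M],
       so [x, x'] is sent into [M]. *)
    assert (E : eqm M (comm (x' ** x ** comm x x') y) (comm (x ** x') y))
      by (replace (x' ** x ** comm x x') with (x ** x') by group_nf; reflexivity).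
    rewrite hom in E; [|now apply gen_mul | assumption | assumption].
    rewrite !hom in E by assumption.
    assert (C : eqm M (comm x y ** comm x' y) (comm x' y ** comm x y)).
    { apply (eqm_sym_commute M), (good_comm gM); auto. }
    rewrite C in E. rewrite <- (eqm_1 M).
    rewrite <- (gmulKV (comm x' y ** comm x y) (comm (comm x x') y)), E, gmulV.
    reflexivity.
  - intros v N j Hv HN H y Hy.
    apply (good_pow gM _ N (j * c)); [auto | assumption |].
    intro k. destruct (H k) as (b & Hb & E).
    destruct (Hball j b y Hb Hy) as (b' & Hb' & Eb).
    exists b'. split; [assumption|]. rewrite Eb.
    rewrite <- (comm_pow_eqm M) by auto.
    unfold eqm in E.
    (* Write v^(N k) as b (b^-1 v^(N k)); the second factor lies in [cent M Y], so its commutator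
       with [y] vanishes modulo [M]. *)
    rewrite <- (gmulVK b (gpow v (N * k))) at 1.
    assert (Gb : generated G X b) by (eapply ball_generated, Hb).
    rewrite hom; [| assumption | | assumption].
    + rewrite (proj2 (eqm_1 M _) (E y Hy)), gmulr1. reflexivity.
    + apply gen_mul; [now apply gen_inv | now apply (normal_pow _)].
Qed.

Lemma commset_invariant X : commset X -> invariant X.
Proof.
  intro H. induction H as [S n iS _ _|X Y HX iX HY iY]; [assumption|].
  intros g z (x & y & Hx & Hy & <-). exists (conj x z), (conj y z).
  rewrite <- conj_comm. auto.
Qed.

Lemma slot_pow X l : slot X l -> exists n, 0 < n /\ forall v, X (l (gpow v n)).
Proof.
  intro H. induction H as [S n Hn H|X Y l y Hl (n & Hn & H) Hy].
  - eauto.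
  - exists n. split; [assumption|]. intro v. exists (l (gpow v n)), y. auto.
Qed.

(** Each commutation with a fixed element maps the normal subgroup [D] into itself and is compatible
    with powers modulo [K], because [D] is abelian modulo [K]. *)
Lemma slot_hom X l D K : slot X l -> normal D -> normal K ->
  (forall x y, D x -> D y -> K (comm x y)) ->
  (forall v, D v -> D (l v)) /\
  (forall v v', eqm K v v' -> eqm K (l v) (l v')) /\
  (forall v n, D v -> eqm K (l (gpow v n)) (gpow (l v) n)).
Proof.
  intros H nD nK HD.
  induction H as [S n Hn H|X Y l y Hl (IH1 & IH2 & IH3) Hy].
  - split; [auto|]. split; [auto|]. reflexivity.
  - split; [|split].
    + intros v Hv. apply (normal_comm_l D). auto.
    + intros v v' E. now rewrite (IH2 v v' E).
    + intros v n Hv. rewrite IH3 by assumption. apply comm_pow_eqm; [assumption|].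
      apply HD; [apply (normal_comm_l D)|]; auto.
Qed.

(** The elements v with [v, x_1, ..., x_k] in [M] for all x_1, ..., x_k in [X]. *)
Definition icent M X (k : nat) : G -> Prop := Nat.iter k (fun K => cent K X) M.

Lemma icent_normal M X k : normal M -> invariant X -> normal (icent M X k).
Proof.
  intros nM iX. induction k; [assumption|]. now apply cent_normal.
Qed.

Lemma icent_mono M M' X X' k :
  (forall v, M v -> M' v) -> (forall K, normal K -> forall v, cent K X v -> cent K X' v) ->
  normal M -> invariant X ->
  forall v, icent M X k v -> icent M' X' k v.
Proof.
  intros HM HX nM iX. induction k; [assumption|]. cbn. intros v Hv y Hy.
  apply IHk. revert y Hy. apply HX; [now apply icent_normal | exact Hv].
Qed.

(** The number [k] is the depth of the leftmost leaf: each fixed entry of a slot is weakened to an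
    arbitrary element of the whole commutator set. *)
Lemma slot_kill X D M : commset X -> normal M ->
  (forall l v, slot X l -> D v -> M (l v)) ->
  exists k, forall v, D v -> icent M X k v.
Proof.
  intro HX. revert M. induction HX as [S n iS Hn HS|X Y HX IHX HY _]; intros M nM H.
  - exists 0%nat. intros v Hv. apply (H (fun v => v)); [now apply slot_leaf with n | exact Hv].
  - pose proof (commset_invariant X HX) as iX.
    pose proof (commset_invariant Y HY) as iY.
    destruct (IHX (cent M Y)) as (k & Hk).
    + now apply cent_normal.
    + intros l v Hl Hv y Hy. apply (H (fun v => comm (l v) y)); [now constructor | exact Hv].
    + exists (S k). intros v Hv. unfold icent. rewrite Nat.iter_succ_r.
      (* By normality, commutators [x, y] lie in both <X> and <Y>, so whatever centralizes [X] or
         [Y] modulo a normal subgroup centralizes them too. *)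
      refine (icent_mono (cent M Y) _ X _ k _ _ _ iX v (Hk v Hv)).
      * intros z Hz g (x & y & Hx & Hy & <-).
        apply (cent_generated M Y z nM Hz).
        apply (normal_comm_r _ (nK := generated_normal Y iY)). now apply gen_in.
      * intros K nK z Hz g (x & y & Hx & Hy & <-).
        apply (cent_generated K X z nK Hz).
        apply (normal_comm_l _ (nK := generated_normal X iX)). now apply gen_in.
      * now apply cent_normal.
Qed.

(** Structural induction with [K] varying, since the hypotheses for the two entries are applied to
    centralizers modulo other subgroups. *)
Theorem commset_good X K : commset X -> good X K -> forall x, X x -> K x.
Proof.
  intro HX. revert K.
  induction HX as [S n iS Hn HS|X Y HX IHX HY IHY]; intros K gK.
  (* All the powers s^(n k) = (s^k)^n lie in [S], so length 1 suffices. *)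
  - intros s Hs. apply (good_pow gK s n 1); [now apply gen_in | assumption|].
    intro k. exists (gpow s (n * k)). split.
    + rewrite Nat.mul_comm, gpow_mul. now apply ball_in.
    + pose proof (good_normal gK). reflexivity.
  - set (W := fun g => exists x y, X x /\ Y y /\ comm x y = g) in *.
    assert (HW : commset W) by (now apply cs_comm).
    pose proof (commset_invariant X HX) as iX.
    pose proof (commset_invariant Y HY) as iY.
    pose proof (commset_invariant W HW) as iW.
    pose proof (good_normal gK) as nK.
    pose proof (generated_normal W iW) as nW.
    assert (Wxy : forall x y, X x -> Y y -> W (comm x y)) by (intros x y; exists x, y; auto).
    set (D := generated G W) in *.
    (* Commutation with a fixed element at most doubles the length of a
       product of conjugates. *)
    assert (gcent : forall M Z, invariant Z -> good W M -> good W (cent M Z)).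
    { intros M Z iZ gM. apply (good_cent W M W Z 2); auto.
      - intros w z Hw Hz. rewrite comm_conj. apply (ball_mul W 1 1).
        + now apply ball_in_V.
        + now apply ball_in, iW.
      - intros d x. apply (good_comm gM). }
    (* [M k] consists of the v with [v, y_1, ..., y_k, x] in [K]. *)
    set (M := icent (cent K X) Y).
    assert (gM : forall j, good W (M j)).
    { induction j; [now apply gcent | now apply gcent]. }
    assert (exists k, forall v, D v -> M k v) as (k & Hk).
    { apply (slot_kill Y D (cent K X) HY); [now apply cent_normal|].
      intros l v Hl Hv x Hx.
      destruct (slot_pow Y l Hl) as (n & Hn & Hpow).
      destruct (slot_hom Y l D K Hl nW nK (good_comm gK)) as (H1 & H2 & H3).
      (* As l(v^(n k)) lies in [Y], its commutator with [x] is the inverse of an element of [W]; by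
         linearity it is congruent to [l(v), x]^(n k). *)
      apply (good_pow gK _ n 1); [now apply (normal_comm_l D), H1 | assumption |].
      intro k. exists (comm (l (gpow v (n * k))) x). split.
      - rewrite <- commV. apply ball_in_V, Wxy; [assumption|].
        rewrite Nat.mul_comm, gpow_mul. apply Hpow.
      - rewrite H3 by assumption. apply comm_pow_eqm; [assumption|].
        apply (good_comm gK); [apply (normal_comm_l D)|]; now apply H1. }
    assert (H0 : forall v, D v -> M 0%nat v).
    { clear - IHY iX iY iW nW gM Hk Wxy. induction k as [|k IHk]; [assumption|].
      apply IHk. clear IHk.
      pose proof (good_normal (gM k)) as nM.
      (* Drop one copy of [Y]: [<W>, <Y>] lies in [M k], so [cent (M k) X] is good for [Y] and
         contains [Y] by induction. Then [W], and with it <W>, lies in [M k]. *)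
      assert (gY : good Y (cent (M k) X)).
      { apply (good_cent W (M k) Y X 1); auto.
        - intros y x Hy Hx. rewrite <- commV. now apply ball_in_V, Wxy.
        - intros d y Hd Hy. apply (cent_generated (M k) Y d); [assumption | now apply Hk |exact Hy]. }
      apply generated_sub; [assumption|].
      intros w (x & y & Hx & Hy & <-). apply (normal_comm_sym _).
      now apply (IHY _ gY). }
    (* No copy of [Y] is left: [X] centralizes <W> modulo [K], and the argument is repeated with the
       entries exchanged. *)
    assert (gX : good X (cent K Y)).
    { apply (good_cent W K X Y 1); auto.
      - intros x y Hx Hy. now apply ball_in, Wxy.
      - intros d x Hd Hx. apply (cent_generated K X d); [assumption | now apply H0 | exact Hx]. }
    intros w (x & y & Hx & Hy & <-). now apply (IHX _ gX).
Qed.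

End Vanishing.

(** * Finiteness: Schur and Dietzmann *)

Section FiniteSets.
Context {A B T : Type}.

Lemma finite_sub (P Q : T -> Prop) :
  (forall x, P x -> Q x) -> finite_set Q -> finite_set P.
Proof. intros H (l & Hl). exists l. auto. Qed.

Lemma finite_exact (P : T -> Prop) : finite_set P ->
  exists l, forall x, In x l <-> P x.
Proof.
  intros (l & Hl).
  exists (filter (fun x => if excluded_middle_informative (P x) then true else false) l).
  intro x. rewrite filter_In.
  destruct (excluded_middle_informative (P x)); split; [tauto | auto | easy | tauto].
Qed.

(** Without a repetition, a choice of [b] for each index would embed [length l + 1] indices into
    [l]. *)
Lemma pigeonhole (R : nat -> T -> Prop) (l : list T) :
  (forall k, exists b, In b l /\ R k b) ->
  exists i j b, i < j /\ R i b /\ R j b.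
Proof.
  intro H.
  set (f := fun k => proj1_sig (constructive_indefinite_description _ (H k))).
  assert (Hf : forall k, In (f k) l /\ R k (f k)).
  { intro k. unfold f. now destruct constructive_indefinite_description. }
  apply NNPP. intro N.
  assert (I : forall i j, f i = f j -> i = j).
  { intros i j E. destruct (Nat.lt_trichotomy i j) as [L|[L|L]]; [|exact L|];
      exfalso; apply N.
    - exists i, j, (f i). split; [exact L|]. split; [apply Hf | rewrite E; apply Hf].
    - exists j, i, (f i). split; [exact L|]. split; [rewrite E; apply Hf | apply Hf]. }
  assert (L : length (map f (seq 0 (S (length l)))) <= length l).
  { apply NoDup_incl_length.
    - apply Injective_map_NoDup; [exact I | apply seq_NoDup].
    - intros x Hx. apply in_map_iff in Hx as (k & <- & _). apply Hf. }
  rewrite length_map, length_seq in L. lia.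
Qed.

(** For each code in the list, [epsilon] selects one preimage; the values of [f] there are all its
    values, as [f] depends only on the code. *)
Lemma finite_factor (P : A -> Prop) (code : A -> B) (f : A -> T) : inhabited A ->
  finite_set (fun b => exists a, P a /\ code a = b) ->
  (forall a a', P a -> P a' -> code a = code a' -> f a = f a') ->
  finite_set (fun t => exists a, P a /\ f a = t).
Proof.
  intros iA (l & Hl) H.
  exists (map (fun b => f (epsilon iA (fun a => P a /\ code a = b))) l).
  intros t (a & Ha & <-). apply in_map_iff. exists (code a). split; [|eauto].
  destruct (epsilon_spec iA (fun a' => P a' /\ code a' = code a)) as (Ha' & E); [eauto|].
  now apply H.
Qed.

Lemma finite_lists (P : T -> Prop) n : finite_set P ->
  finite_set (fun l => length l = n /\ Forall P l).
Proof.
  intros (L & HL). induction n as [|n (Ln & IH)].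
  - exists [[]]. intros [|x l] (E & _); [now left | discriminate].
  - exists (map (fun p => fst p :: snd p) (list_prod L Ln)).
    intros [|x l] (E & F); [discriminate|]. inversion_clear F.
    apply in_map_iff. exists (x, l). split; [reflexivity|].
    apply in_prod; [auto|]. apply IH. auto.
Qed.

Lemma uniform_bound (P : T -> nat -> Prop) (L : list T) :
  (forall x, In x L -> exists e, P x e) ->
  exists E, forall x, In x L -> exists e, e <= E /\ P x e.
Proof.
  induction L as [|a L IH]; intro H.
  - exists 0%nat. intros x [].
  - destruct IH as (E & HE); [intros; apply H; now right|].
    destruct (H a) as (e & He); [now left|].
    exists (e + E). intros x [<-|Hx].
    + exists e. split; [lia | assumption].
    + destruct (HE x Hx) as (e' & L' & He'). exists e'. split; [lia | assumption].
Qed.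

End FiniteSets.

Definition eqd {T : Type} (x y : T) : {x = y} + {x <> y} :=
  excluded_middle_informative (x = y).

Lemma length_count_bound {T} (L l : list T) E :
  incl l L -> (forall x, In x L -> count_occ eqd l x <= E) ->
  length l <= length L * E.
Proof.
  revert l. induction L as [|a L IH]; intros l Hl Hc.
  - destruct l as [|x l]; [easy|]. destruct (Hl x); now left.
  - assert (S1 : length l = count_occ eqd l a + length (remove eqd a l)).
    { clear. induction l as [|x l IH]; cbn; [easy|].
      destruct (eqd x a), (eqd a x); subst; cbn; try congruence; lia. }
    assert (S2 : forall x, count_occ eqd (remove eqd a l) x <= count_occ eqd l x).
    { intro x. clear. induction l as [|y l IH]; cbn; [easy|].
      destruct (eqd a y); cbn; destruct (eqd y x); lia. }
    assert (S3 : length (remove eqd a l) <= length L * E).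
    { apply IH.
      - intros x Hx. apply in_remove in Hx as (Hx & N).
        destruct (Hl x Hx) as [<-|]; [easy | assumption].
      - intros x Hx. etransitivity; [apply S2 | apply Hc; now right]. }
    specialize (Hc a (or_introl eq_refl)). cbn. lia.
Qed.

(** * Finiteness of groups generated by finite invariant sets *)

Section FiniteGroups.
Context {G : group}.
Implicit Types X W : G -> Prop.

Fixpoint gprod (l : list G) : G :=
  match l with [] => 1 | x :: l => x ** gprod l end.

Definition torsion (x : G) : Prop := exists k, 0 < k /\ gpow x k = 1.

Lemma gprod_app l l' : gprod (l ++ l') = gprod l ** gprod l'.
Proof. induction l; cbn; [group_nf | rewrite IHl; group_nf]. Qed.

Lemma gprod_repeat x n : gprod (repeat x n) = gpow x n.
Proof. induction n; cbn; [easy | now rewrite IHn]. Qed.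

Lemma gprod_ball X l : Forall X l -> ball X (length l) (gprod l).
Proof.
  induction 1; cbn; [apply ball_1|]. apply (ball_mul X 1); [now apply ball_in | assumption].
Qed.

Lemma finite_ball X n : finite_set X -> finite_set (ball X n).
Proof.
  intros (L & HL). induction n as [|n (Ln & IH)].
  - exists [1]. intros x Hx. inversion Hx. now left.
  - exists (1 :: map (fun p => fst p ** snd p) (list_prod Ln (L ++ map (ginv G) L))).
    intros x Hx. inversion_clear Hx as [|? a b Ha Hb]; [now left|]. right.
    apply in_map_iff. exists (a, b). split; [reflexivity|].
    apply in_prod; [auto|]. apply in_app_iff.
    destruct Hb as [Hb|Hb]; [auto|]. right.
    apply in_map_iff. exists b^-1. split; [apply ginvK | auto].
Qed.

Lemma generated_gprod X g : (forall x, X x -> X x^-1) -> generated G X g ->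
  exists l, Forall X l /\ gprod l = g.
Proof.
  intros VX H. induction H as [g H| |g h _ (l & Fl & <-) _ (l' & Fl' & <-)|g _ (l & Fl & <-)].
  - exists [g]. split; [now constructor | cbn; group_nf].
  - now exists [].
  - exists (l ++ l'). split; [now apply Forall_app | apply gprod_app].
  - exists (rev (map (ginv G) l)). split.
    + apply Forall_rev, Forall_map. revert Fl. apply Forall_impl. auto.
    + clear. induction l; cbn; [group_nf|].
      rewrite gprod_app, IHl. cbn. group_nf.
Qed.

(** Moving copies of [x] to the front past a letter conjugates that letter, which keeps it in the
    invariant set [X] and preserves the length. *)
Lemma gprod_collect X x e l : invariant X -> Forall X l -> e <= count_occ eqd l x ->
  exists l', Forall X l' /\ length l = e + length l' /\ gprod l = gpow x e ** gprod l'.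
Proof.
  intros iX F. revert e. induction F as [|y t Hy F IH]; intros e He; cbn in He.
  - replace e with 0%nat by lia. exists []. cbn. split; [constructor|]. split; [easy|group_nf].
  - destruct (eqd y x) as [->|N].
    + destruct e as [|e].
      * exists (x :: t). split; [now constructor|]. split; [easy | cbn; group_nf].
      * destruct (IH e) as (l' & F' & L' & E); [lia|].
        exists l'. split; [assumption|]. cbn. rewrite E, L'. split; [easy | group_nf].
    + destruct (IH e He) as (l' & F' & L' & E).
      exists (conj y (gpow x e) :: l'). split; [constructor; auto|].
      cbn. rewrite L', E. split; [lia | group_nf].
Qed.

(* In a long product some generator occurs often enough to be collected at
   the front and rewritten as a shorter word. *)
Lemma finite_generated X : finite_set X -> invariant X -> (forall x, X x -> X x^-1) ->
  (forall x, X x -> exists e l, length l < e /\ Forall X l /\ gprod l = gpow x e) ->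
  finite_set (generated G X).
Proof.
  intros fX iX VX H. destruct (finite_exact X fX) as (L & HL).
  destruct (uniform_bound (fun x e => exists l, length l < e /\ Forall X l /\ gprod l = gpow x e) L)
    as (E & HE).
  { intros x Hx. now apply H, HL. }
  apply finite_sub with (ball X (length L * E)); [|now apply finite_ball].
  intros g Hg. apply generated_gprod in Hg as (l & Fl & <-); [|assumption].
  (* Induct on a bound for the length, since a rewriting step may shorten the product by any
     amount. *)
  remember (length l) as n eqn:En. assert (Ln : length l <= n) by lia. clear En.
  revert l Ln Fl. induction n as [|n IH]; intros l Ln Fl.
  - destruct l; [apply ball_1 | cbn in Ln; lia].
  - destruct (Nat.le_gt_cases (length l) (length L * E)) as [S|S].
    + apply ball_le with (length l); [assumption | now apply gprod_ball].
    + assert (exists x, In x L /\ E < count_occ eqd l x) as (x & Hx & Cx).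
      { apply NNPP. intro N. apply (Nat.lt_irrefl (length l)).
        eapply Nat.le_lt_trans; [|exact S]. apply length_count_bound.
        - intros y Hy. apply HL. rewrite Forall_forall in Fl. auto.
        - intros y Hy. apply Nat.nlt_ge. intro. apply N. eauto. }
      destruct (HE x Hx) as (e & Le & l0 & Ll0 & Fl0 & E0).
      destruct (gprod_collect X x e l iX Fl) as (l' & Fl' & Ll' & E'); [lia|].
      rewrite E', <- E0, <- gprod_app. apply IH.
      * rewrite length_app. lia.
      * now apply Forall_app.
Qed.

Lemma torsion_of_pow_eq x i j : i < j -> gpow x i = gpow x j -> torsion x.
Proof.
  intros L E. exists (j - i). split; [lia|].
  replace j with (i + (j - i)) in E by lia. rewrite gpow_add in E.
  apply (gmul_cancel_l (gpow x i)). now rewrite <- E, gmulr1.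
Qed.

Lemma torsion_of_pow x n : 0 < n -> torsion (gpow x n) -> torsion x.
Proof.
  intros Hn (k & Hk & E). exists (n * k). split; [lia | now rewrite gpow_mul].
Qed.

Lemma finite_torsion X : normal X -> finite_set X -> forall x, X x -> torsion x.
Proof.
  intros nX (l & Hl) x Hx.
  destruct (pigeonhole (fun k b => b = gpow x k) l) as (i & j & b & L & -> & E).
  - intro k. exists (gpow x k). split; [|reflexivity]. now apply Hl, (normal_pow X).
  - now apply torsion_of_pow_eq with i j.
Qed.

(** Once inverses are adjoined, x^k = 1 rewrites x^k as the empty product, which is shorter. *)
Lemma dietzmann W : finite_set W -> invariant W -> (forall x, W x -> torsion x) ->
  finite_set (generated G W).
Proof.
  intros (L & HL) iW tW.
  apply finite_sub with (generated G (fun x => W x \/ W x^-1)).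
  { intros x H. induction H; [apply gen_in; auto | apply gen_one | now apply gen_mul
      | now apply gen_inv]. }
  apply finite_generated.
  - exists (L ++ map (ginv G) L). intros x [H|H]; apply in_app_iff; [auto|right].
    apply in_map_iff. exists x^-1. split; [apply ginvK | auto].
  - intros x y [H|H]; [left | right; rewrite <- conjV]; now apply iW.
  - intros x. rewrite ginvK. tauto.
  - intros x H. assert (torsion x) as (k & Hk & E).
    { destruct H as [H|H]; [auto|]. destruct (tW _ H) as (k & Hk & E).
      exists k. split; [assumption|].
      now rewrite <- (ginvK x), gpow_inv, E, ginv1. }
    exists k, []. now rewrite E.
Qed.

Definition commutators (D : G -> Prop) : G -> Prop :=
  fun g => exists x y, D x /\ D y /\ comm x y = g.

(** As c^(p+1) equals its conjugate by [y], c^(p+2) = c c^y (c^y)^p, and c c^y = [x, y^2]. So p + 2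
    commutators become p + 1. *)
Lemma comm_pow_shorten (x y : G) p : let c := comm x y in
  gpow c (S p) ** y = y ** gpow c (S p) ->
  gpow c (S (S p)) = comm x (y ** y) ** gpow (conj c y) p.
Proof.
  intros c C. rewrite gpow_conj.
  transitivity (x^-1 ** y^-1 ** x ** (y ** gpow c (S p))).
  - cbn. unfold c at 1. group_nf.
  - rewrite <- C. cbn. unfold c at 1. group_nf.
Qed.

Lemma conj_inj (x y z : G) : conj x z = conj y z -> x = y.
Proof.
  intro E. apply (f_equal (fun t => conj t z^-1)) in E. revert E. group_nf. easy.
Qed.

Lemma conj_eq_generated W x x' : (forall w, W w -> conj w x = conj w x') ->
  forall d, generated G W d -> conj d x = conj d x'.
Proof.
  intros H d Hd. induction Hd.
  - auto.
  - group_nf.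
  - now rewrite !conjM, IHHd1, IHHd2.
  - now rewrite !conjV, IHHd.
Qed.

(* Elements of D enter a commutator only through their conjugation action on
   the finite set W. *)
Lemma schur W : finite_set W -> invariant W ->
  finite_set (generated G (commutators (generated G W))).
Proof.
  intros fW iW. pose proof (generated_normal W iW) as nD.
  destruct (finite_exact W fW) as (L & HL).
  set (code := fun g => map (fun w => conj w g) L).
  destruct (finite_lists W (length L) fW) as (LL & HLL).
  assert (Hcode : forall g, In (code g) LL).
  { intro g. apply HLL. split; [apply length_map|].
    apply Forall_map, Forall_forall. intros w Hw. now apply iW, HL. }
  assert (codeE : forall x x', code x = code x' ->
    forall d, generated G W d -> conj d x = conj d x').
  { intros x x' E. apply conj_eq_generated. intros w Hw. apply HL in Hw.
    revert w Hw. now apply ext_in_map. }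
  apply finite_generated.
  - apply finite_sub with (fun t => exists p : G * G,
      (generated G W (fst p) /\ generated G W (snd p)) /\ comm (fst p) (snd p) = t).
    { intros g (x & y & Hx & Hy & <-). exists (x, y). auto. }
    apply finite_factor with (code := fun p => (code (fst p), code (snd p))).
    + constructor. exact (1, 1).
    + exists (list_prod LL LL). intros b (p & _ & <-). now apply in_prod.
    + intros (x, y) (x', y') (Hx & Hy) (Hx' & Hy') E. cbn in *. injection E as E E'.
      (* Change one entry at a time; inverting a commutator exchanges its entries. *)
      transitivity (comm x y').
      * now rewrite !comm_conj, (codeE y y').
      * rewrite <- (commV y' x), <- (commV y' x'). now rewrite !comm_conj, (codeE x x').
  - intros g z (x & y & Hx & Hy & <-). exists (conj x z), (conj y z).
    rewrite conj_comm. split; [|split]; [| |reflexivity]; now apply (normal_J nD).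
  - intros g (x & y & Hx & Hy & <-). exists y, x. now rewrite commV.
  - intros c (x & y & Hx & Hy & <-). set (c := comm x y).
    (* Two powers c^i and c^j act alike on [W], hence on [y], so c^(p+1) with p = j - i - 1
       centralizes [y]. *)
    destruct (pigeonhole (fun k b => b = code (gpow c k)) LL)
      as (i & j & b & Lij & -> & E); [intro k; eauto|].
    specialize (codeE _ _ E y Hy).
    replace j with (S (j - i - 1) + i) in codeE by lia.
    set (p := j - i - 1) in codeE.
    rewrite gpow_add, <- conj_conj in codeE. apply conj_inj in codeE.
    exists (S (S p)), (comm x (y ** y) :: repeat (conj c y) p). split; [|split].
    + cbn. rewrite repeat_length. lia.
    + constructor.
      * exists x, (y ** y). split; [assumption|]. split; [now apply gen_mul | easy].
      * apply Forall_forall. intros z Hz. apply repeat_spec in Hz as ->.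
        unfold c. rewrite conj_comm. exists (conj x y), (conj y y).
        split; [|split]; [| |reflexivity]; now apply (normal_J nD).
    + cbn [gprod]. rewrite gprod_repeat. symmetry. apply comm_pow_shorten. fold c.
      rewrite codeE at 1. now group_nf.
Qed.

Theorem commset_finite W : commset W -> finite_set W -> finite_set (generated G W).
Proof.
  intros HW fW. pose proof (commset_invariant W HW) as iW.
  apply dietzmann; [assumption | assumption |].
  pose proof (generated_normal W iW) as nD.
  set (D := generated G W) in *. set (D' := generated G (commutators D)).
  assert (nD' : normal D').
  { apply generated_normal. intros g z (x & y & Hx & Hy & <-).
    exists (conj x z), (conj y z). rewrite conj_comm.
    split; [|split]; [| |reflexivity]; now apply (normal_J nD). }
  assert (tD' : forall x, D' x -> torsion x).
  { apply finite_torsion; [assumption | now apply schur]. }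
  assert (cD' : forall x y, D x -> D y -> D' (comm x y)).
  { intros x y Hx Hy. apply gen_in. now exists x, y. }
  set (K := fun x => D x /\ torsion x).
  assert (nK : normal K).
  { split.
    - split; [apply gen_one|]. exists 1%nat. split; [lia | apply gpow_one].
    - intros x y (Dx & a & Ha & Ea) (Dy & b & Hb & Eb).
      (* Modulo [D'] the factors commute, so (x y)^(a b) lies in [D'], which is torsion. *)
      split; [now apply gen_mul|]. apply torsion_of_pow with (a * b); [nia|].
      apply tD'. rewrite (gpow_mul_eqm D') by auto.
      rewrite gpow_mul, (Nat.mul_comm a b), gpow_mul, Ea, Eb, !gpow_one, gmul1.
      apply gen_one.
    - intros x (Dx & a & Ha & Ea). split; [now apply gen_inv|].
      exists a. now rewrite gpow_inv, Ea, ginv1.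
    - intros x y (Dx & a & Ha & Ea). split; [now apply (normal_J nD)|].
      exists a. rewrite gpow_conj, Ea. split; [assumption | group_nf]. }
  assert (gK : good W K).
  { split; [assumption | |].
    - intros x y Hx Hy. split; [now apply (normal_comm_l D) | auto].
    (* The ball is finite, so two powers v^(N i) and v^(N i') are congruent modulo [K] to the same
       element; their quotient is torsion, and so is [v]. *)
    - intros v N j Hv HN H. destruct (finite_ball W j fW) as (L & HL).
      destruct (pigeonhole (fun k b => eqm K b (gpow v (N * k))) L)
        as (i & i' & b & Li & E & E').
      { intro k. destruct (H k) as (b & Hb & E). eauto. }
      split; [assumption|]. rewrite E in E'. unfold eqm in E'.
      replace i' with (i + (i' - i)) in E' by lia.
      rewrite Nat.mul_add_distr_l, gpow_add, gmulKV in E'.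
      apply torsion_of_pow with (N * (i' - i)); [nia | apply E']. }
  intros x Hx. exact (proj2 (commset_good W K HW gK x Hx)).
Qed.

End FiniteGroups.

(** * Word values *)

Section Words.
Context {G : group}.

Lemma eval_conj (f : nat -> G) w y :
  eval G (fun i => conj (f i) y) w = conj (eval G f w) y.
Proof.
  induction w; cbn.
  - reflexivity.
  - group_nf.
  - now rewrite conjM, IHw1, IHw2.
  - now rewrite conjV, IHw.
Qed.

Lemma eval_ext (f f' : nat -> G) w : (forall i, In i (vars w) -> f i = f' i) ->
  eval G f w = eval G f' w.
Proof.
  induction w; cbn; intro H.
  - auto.
  - reflexivity.
  - rewrite IHw1, IHw2; [reflexivity | |]; intros; apply H, in_app_iff; auto.
  - now rewrite IHw.
Qed.

Lemma values_invariant w : invariant (values G w).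
Proof. intros x y (f & <-). eexists. apply eval_conj. Qed.

(** With the other variables trivial, the value is [y] to the exponent sum, split into two natural
    exponents because [gpow] takes no negative ones. *)
Lemma eval_single i w : exists a b, expsum i w = (Z.of_nat a - Z.of_nat b)%Z /\
  forall y : G, eval G (fun j => if Nat.eqb j i then y else 1) w
    = gpow y a ** (gpow y b)^-1.
Proof.
  induction w as [j| |w1 (a1 & b1 & E1 & H1) w2 (a2 & b2 & E2 & H2)|w (a & b & E & H)]; cbn.
  - destruct (Nat.eqb j i); [exists 1%nat, 0%nat | exists 0%nat, 0%nat];
      (split; [reflexivity | intro y; cbn; group_nf]).
  - exists 0%nat, 0%nat. split; [reflexivity | intro y; cbn; group_nf].
  - exists (a1 + a2), (b1 + b2). split; [lia|]. intro y.
    assert (C : (gpow y b1)^-1 ** gpow y a2 = gpow y a2 ** (gpow y b1)^-1).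
    { apply (gmul_cancel_l (gpow y b1)).
      rewrite gmulVK, gmulA, gpow_comm. now group_nf. }
    rewrite H1, H2, !gpow_add, (gpow_comm y b1 b2), ginvM.
    rewrite <- !gmulA, (gmulA _ (gpow y b1)^-1), C. now group_nf.
  - exists b, a. split; [lia|]. intro y. rewrite H. group_nf.
Qed.

(** This makes the values of a non-commutator word a leaf of a commutator set. For a negative
    exponent sum, [y^-1] is substituted. *)
Lemma noncommutator_powers u : noncommutator u ->
  exists n, 0 < n /\ forall y, values G u (gpow y n).
Proof.
  intros (i & Hi). destruct (eval_single i u) as (a & b & E & H).
  destruct (Nat.lt_trichotomy a b) as [L|[L|L]]; [| lia |].
  - exists (b - a). split; [lia|]. intro y.
    exists (fun j => if Nat.eqb j i then y^-1 else 1).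
    rewrite H, !gpow_inv, ginvK. replace b with (a + (b - a)) at 1 by lia.
    rewrite gpow_add. apply gmulKV.
  - exists (a - b). split; [lia|]. intro y.
    exists (fun j => if Nat.eqb j i then y else 1).
    rewrite H. replace a with ((a - b) + b) at 1 by lia.
    rewrite gpow_add. group_nf.
Qed.

Lemma vars_subst u w x : In x (vars (subst u w)) ->
  exists i, In i (vars w) /\ In x (vars (u i)).
Proof.
  induction w; cbn; intro H.
  - eauto.
  - contradiction.
  - apply in_app_iff in H as [H|H].
    + destruct (IHw1 H) as (i & Hi & Hx). exists i. rewrite in_app_iff. auto.
    + destruct (IHw2 H) as (i & Hi & Hx). exists i. rewrite in_app_iff. auto.
  - auto.
Qed.

(** Disjointness lets the assignments realizing the two entries be merged into one. *)
Lemma values_Comm a b (g : G) : (forall x, In x (vars a) -> ~ In x (vars b)) ->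
  values G (Comm a b) g <->
  exists x y, values G a x /\ values G b y /\ comm x y = g.
Proof.
  intro H. split.
  - intros (f & <-). exists (eval G f a), (eval G f b).
    split; [|split]; [now exists f | now exists f | reflexivity].
  - intros (x & y & (f & <-) & (f' & <-) & <-).
    set (h := fun i => if in_dec Nat.eq_dec i (vars a) then f i else f' i).
    exists h. change (eval G h (Comm a b)) with (comm (eval G h a) (eval G h b)).
    f_equal; apply eval_ext; intros i Hi; unfold h;
      destruct (in_dec Nat.eq_dec i (vars a)) as [Ha|Ha]; firstorder.
Qed.

(** [X] agrees with the value set only pointwise, because the values of a commutator word are not
    literally of the form required by [cs_comm]. *)
Lemma outer_comm_commset w u : outer_comm w ->
  (forall i, In i (vars w) -> noncommutator (u i)) ->
  (forall i j, In i (vars w) -> In j (vars w) -> i <> j ->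
     forall x, In x (vars (u i)) -> ~ In x (vars (u j))) ->
  exists X : G -> Prop, commset X /\ forall g, X g <-> values G (subst u w) g.
Proof.
  induction 1 as [n|a b Ha IHa Hb IHb Hab]; intros Hu Hd.
  - destruct (noncommutator_powers (u n)) as (m & Hm & Hp); [apply Hu; now left|].
    exists (values G (u n)). split; [|easy].
    apply cs_leaf with m; [apply values_invariant | assumption | assumption].
  - assert (Ia : forall i, In i (vars a) -> In i (vars (Comm a b)))
      by (intros i Hi; cbn; rewrite !in_app_iff; auto).
    assert (Ib : forall i, In i (vars b) -> In i (vars (Comm a b)))
      by (intros i Hi; cbn; rewrite !in_app_iff; auto).
    destruct (IHa (fun i Hi => Hu i (Ia i Hi))
      (fun i j Hi Hj => Hd i j (Ia i Hi) (Ia j Hj))) as (X & HX & EX).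
    destruct (IHb (fun i Hi => Hu i (Ib i Hi))
      (fun i j Hi Hj => Hd i j (Ib i Hi) (Ib j Hj))) as (Y & HY & EY).
    exists (fun g => exists x y, X x /\ Y y /\ comm x y = g).
    split; [now apply cs_comm|]. intro g.
    change (subst u (Comm a b)) with (Comm (subst u a) (subst u b)).
    rewrite values_Comm.
    + split; intros (x & y & Hx & Hy & E); exists x, y; firstorder.
    + intros x Hx Hx'. apply vars_subst in Hx as (i & Hi & Hx).
      apply vars_subst in Hx' as (j & Hj & Hx').
      assert (i <> j) by (intros <-; now apply (Hab i)).
      now apply (Hd i j) with x; auto.
Qed.

End Words.

(** * Conciseness, and the case of powers of variables *)

Lemma vars_wpow i n x : In x (vars (wpow (Var i) n)) -> x = i.
Proof.
  assert (H : forall k, In x (vars (wpow_nat (Var i) k)) -> x = i).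
  { induction k; cbn; [easy|]. rewrite in_app_iff. cbn. intuition. }
  destruct n; cbn; [easy | apply H | apply H].
Qed.

Lemma expsum_wpow i n : expsum i (wpow (Var i) n) = n.
Proof.
  assert (H : forall k, expsum i (wpow_nat (Var i) k) = Z.of_nat k).
  { induction k; cbn [wpow_nat expsum]; [easy|]. rewrite IHk, Nat.eqb_refl. lia. }
  destruct n; cbn; rewrite ?H; lia.
Qed.

Lemma concise_subst (w : word) (u : nat -> word) : outer_comm w ->
  (forall i, In i (vars w) -> noncommutator (u i)) ->
  (forall i j, In i (vars w) -> In j (vars w) -> i <> j ->
     forall x, In x (vars (u i)) -> ~ In x (vars (u j))) ->
  concise (subst u w).
Proof.
  intros Hw Hu Hd G fin.
  destruct (outer_comm_commset (G := G) w u Hw Hu Hd) as (X & HX & E).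
  apply finite_sub with (generated G X).
  - intros x H. induction H; [now apply gen_in, E | apply gen_one
      | now apply gen_mul | now apply gen_inv].
  - apply commset_finite; [assumption|]. revert fin. apply finite_sub. apply E.
Qed.

Theorem theoremA :
  (forall (w : word) (u : nat -> word),
     outer_comm w ->
     (forall i, In i (vars w) -> noncommutator (u i)) ->
     (forall i j, In i (vars w) -> In j (vars w) -> i <> j ->
        forall x, In x (vars (u i)) -> ~ In x (vars (u j))) ->
     concise (subst u w)) /\
  (forall (w : word) (n : nat -> Z),
     outer_comm w ->
     (forall i, In i (vars w) -> n i <> 0%Z) ->
     concise (subst (fun i => wpow (Var i) (n i)) w)).
Proof.
  split; [exact concise_subst|].
  intros w n Hw Hn. apply concise_subst; [assumption | |].
  - intros i Hi. exists i. rewrite expsum_wpow. auto.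
  - intros i j _ _ Nij x Hx Hx'. apply vars_wpow in Hx, Hx'. congruence.
Qed.
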